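(* Let $s, t, n$ be positive integers such that $s > \left\lfloor \frac{n-t+1}{2} \right\rfloor$ and $s+t \le n+1$. Then $f_{s,s+t}(n) = n-t$.
   Context: All graphs are finite, undirected, and simple. The Erdős–Rogers function is defined by $$f_{s,s+t}(n) = \min_{G} \max\{ |S| : S \subseteq V(G) \text{ and the induced subgraph } G[S] \text{ contains no } K_s \},$$ where the minimum is taken over all graphs $G$ on $n$ vertices that contain no $K_{s+t}$ ($K_r$ denotes the complete graph on $r$ vertices, i.e. a clique of size $r$). *)

(* Defs.v *)
From mathcomp Require Import all_boot.

Set Implicit Arguments.
Unset Strict Implicit.
Unset Printing Implicit Defensive.

(* A finite simple graph on the vertex type T is given by its set of edges,
   each edge being an unordered pair of distinct vertices. *)
Definition graph (T : finType) : finType :=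
  {E : {set {set T}} | [forall e in E, #|e| == 2]}.

Definition adjacent (T : finType) (G : graph T) (x y : T) : bool :=
  [set x; y] \in val G.

Definition clique (T : finType) (G : graph T) (K : {set T}) : bool :=
  [forall x in K, forall y in K, (x != y) ==> adjacent G x y].

(* The induced subgraph G[S] contains K_r. *)
Definition induced_has_K (T : finType) (G : graph T) (S : {set T}) (r : nat)
    : bool :=
  [exists K : {set T}, [&& K \subset S, #|K| == r & clique G K]].

Definition K_free (T : finType) (G : graph T) (r : nat) : bool :=
  ~~ induced_has_K G [set: T] r.

Definition max_induced_K_free (T : finType) (G : graph T) (s : nat) : nat :=
  \max_(S : {set T} | ~~ induced_has_K G S s) #|S|.

(* f_{s,r}(n), with 'I_n as the n-element vertex set.  Every minimized value is
   at most n, so starting from the default value n does not alter the minimum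
   when some K_r-free graph on n vertices exists (in particular for r >= 2);
   otherwise the value is n by convention. *)
Definition erdos_rogers (s r n : nat) : nat :=
  \big[minn/n]_(G : graph 'I_n | K_free G r) max_induced_K_free G s.

(* Main.v *)
Require Import Defs.
From mathcomp Require Import all_boot zify.

Set Implicit Arguments.
Unset Strict Implicit.
Unset Printing Implicit Defensive.

(** Upper bound: in the disjoint union of K_(s+t-1) and n-s-t+1 isolated
    vertices, a K_s-free set misses at least t vertices of the clique.

    Lower bound: Hajnal's inequality says that a nonempty family of maximum
    cliques, of size w, satisfies |intersection| + |union| >= 2w.  Hence if a
    graph has fewer than 2w vertices, its maximum cliques share a vertex, and
    deleting it lowers the clique number.  The hypothesis on s says that
    n <= 2s + t - 2, which is exactly what is needed to repeat this t times,
    going from a K_(s+t)-free graph to a K_s-free one. *)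

Lemma exists_subset_card (T : finType) (A : {set T}) (k : nat) :
  k <= #|A| -> exists2 B : {set T}, B \subset A & #|B| = k.
Proof.
move=> le_k; exists [set x in take k (enum A)].
  by apply/subsetP=> x; rewrite inE => /mem_take; rewrite mem_enum.
rewrite cardsE (card_uniqP _) ?take_uniq ?enum_uniq //.
by rewrite size_takel // -cardE.
Qed.

(** [minn] has no neutral element on nat, so the fold is unrolled along the index list; the default
    [x0] enters only at its end and can only lower the result. *)
Lemma bigminn_le_cond (I : finType) (P : pred I) (F : I -> nat) (x0 : nat)
    (i : I) : P i -> \big[minn/x0]_(j | P j) F j <= F i.
Proof.
move=> Pi; have := mem_index_enum i.
elim: (index_enum I) => [//|j r IHr]; rewrite inE big_cons.
case: eqVneq => [<- _|_ /= /IHr IH]; first by rewrite Pi geq_minl.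
by case: (P j) => //; apply: leq_trans (geq_minr _ _) IH.
Qed.

Section Cliques.

Variables (T : finType) (G : graph T).
Implicit Types (A B C K S V : {set T}).

Lemma adjacent_sym x y : adjacent G x y = adjacent G y x.
Proof. by rewrite /adjacent setUC. Qed.

Lemma cliqueP K :
  reflect {in K &, forall x y, x != y -> adjacent G x y} (clique G K).
Proof.
apply: (iffP forall_inP) => [cK x y /cK /forall_inP cKx /cKx /implyP //|cK x Kx].
by apply/forall_inP=> y Ky; apply/implyP; apply: cK.
Qed.

Lemma clique_sub A B : A \subset B -> clique G B -> clique G A.
Proof.
by move/subsetP=> sAB /cliqueP cB; apply/cliqueP=> x y /sAB Bx /sAB; apply: cB.
Qed.

Lemma induced_has_KP V r :
  reflect (exists K, [/\ K \subset V, #|K| = r & clique G K])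
          (induced_has_K G V r).
Proof.
apply: (iffP existsP) => [[K /and3P[sKV /eqP cardK cK]]|[K [sKV cardK cK]]].
  by exists K.
by exists K; rewrite sKV cardK eqxx.
Qed.

Lemma induced_has_K_le V K r :
  K \subset V -> clique G K -> r <= #|K| -> induced_has_K G V r.
Proof.
move=> sKV cK /exists_subset_card[B sBK cardB].
apply/induced_has_KP; exists B; split=> //; first exact: subset_trans sKV.
exact: clique_sub cK.
Qed.

Lemma induced_has_K_sub A B r :
  A \subset B -> induced_has_K G A r -> induced_has_K G B r.
Proof.
move=> sAB /induced_has_KP[K [sKA <- cK]].
exact: induced_has_K_le (subset_trans sKA sAB) cK (leqnn _).
Qed.

(** Induction on the family. For the intersection [I] and union [U] of the cliques after [C], every
    vertex of [I] is adjacent to all other vertices of [U]. Hence [I :|: C :&: U] is a clique, of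
    size at most [w], and this bounds the loss when [C] is added. *)
Lemma hajnal_clique_inequality V w (F : seq {set T}) :
    {in F, forall C, [/\ C \subset V, #|C| = w & clique G C]} ->
    ~~ induced_has_K G V w.+1 -> F != [::] ->
  w.*2 <= #|\bigcap_(C <- F) C| + #|\bigcup_(C <- F) C|.
Proof.
move=> maxF noK; elim: F maxF => [//|C F IHF] maxF _; rewrite !big_cons.
have [sCV cardC cC] := maxF C (mem_head _ _).
have [->|F_neq0] := eqVneq F [::].
  by rewrite !big_nil setIT setU0 cardC addnn.
have {}maxF: {in F, forall D : {set T},
    [/\ D \subset V, #|D| = w & clique G D]}.
  by move=> D FD; apply: maxF; rewrite inE FD orbT.
have {IHF} := IHF maxF F_neq0.
set I := \bigcap_(D <- F) D; set U := \bigcup_(D <- F) D => leIU.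
have UP x : x \in U -> exists2 D, D \in F & x \in D.
  by rewrite /U bigcup_seq => /bigcupP[D FD Dx]; exists D.
have IP x D : x \in I -> D \in F -> x \in D.
  by move=> + FD; rewrite /I (big_rem D) //= inE => /andP[].
have adjIU x y : x \in I -> y \in U -> x != y -> adjacent G x y.
  move=> Ix /UP[D FD Dy]; have [_ _ /cliqueP cD] := maxF D FD.
  by apply: cD => //; apply: IP FD.
(* Nonemptiness of [F] matters here: the empty intersection is all of [T]. *)
have sIU : I \subset U.
  case: F F_neq0 @I @U IP UP {leIU maxF adjIU} => // D F _ I U IP _.
  apply/subsetP=> x Ix; rewrite /U big_cons inE (IP x D) ?mem_head //.
have sUV : U \subset V.
  apply/subsetP=> x /UP[D FD Dx]; have [/subsetP sDV _ _] := maxF D FD.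
  exact: sDV.
have clK : clique G (I :|: C :&: U).
  apply/cliqueP=> x y; rewrite !inE.
  case/orP=> [Ix|/andP[Cx Ux]] /orP[Iy|/andP[Cy Uy]] neq_xy.
  - by apply: adjIU => //; apply: (subsetP sIU).
  - exact: adjIU.
  - by rewrite adjacent_sym; apply: adjIU; rewrite // eq_sym.
  - by move/cliqueP: cC; apply.
have leK : #|I :|: C :&: U| <= w.
  rewrite leqNgt; apply: contra noK => ltK.
  apply: induced_has_K_le clK ltK; rewrite subUset (subset_trans sIU sUV).
  exact: subset_trans (subsetIl _ _) sCV.
(* With [leK], these two counts give |C ∩ I| + |C ∪ U| >= |I| + |U|. *)
have := cardsUI I (C :&: U); have := cardsUI C U.
have -> : I :&: (C :&: U) = C :&: I.
  by rewrite setICA (setIidPl sIU).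
lia.
Qed.

Lemma exists_clique_transversal_vertex V w :
    #|V| < w.*2 -> induced_has_K G V w -> ~~ induced_has_K G V w.+1 ->
  exists2 v, v \in V & ~~ induced_has_K G (V :\ v) w.
Proof.
move=> ltV /induced_has_KP[C0 [sC0V cardC0 cC0]] noK.
(* [F] lists all [w]-cliques in [V], so a vertex common to [F] meets each of them. *)
pose F := enum [pred C : {set T} | [&& C \subset V, #|C| == w & clique G C]].
have FP C : (C \in F) = [&& C \subset V, #|C| == w & clique G C].
  by rewrite mem_enum.
have FC0 : C0 \in F by rewrite FP sC0V cardC0 eqxx.
have maxF : {in F, forall C, [/\ C \subset V, #|C| = w & clique G C]}.
  by move=> C; rewrite FP => /and3P[? /eqP].
have F_neq0 : F != [::] by apply: contraTneq FC0 => ->.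
have := hajnal_clique_inequality maxF noK F_neq0.
have leU : #|\bigcup_(C <- F) C| <= #|V|.
  by apply: subset_leq_card; rewrite bigcup_seq; apply/bigcupsP=> C /maxF[].
move=> leIU; have /card_gt0P[v Iv] : 0 < #|\bigcap_(C <- F) C|.
  rewrite -(ltn_add2r #|V|) add0n; apply: leq_trans ltV (leq_trans leIU _).
  by rewrite leq_add2l.
have vF C : C \in F -> v \in C.
  by move=> FC; move: Iv; rewrite (big_rem C) //= inE => /andP[].
exists v; first exact: (subsetP sC0V) (vF _ FC0).
apply/induced_has_KP=> -[K [sKV cardK cK]].
have /vF/(subsetP sKV) : K \in F.
  by rewrite FP cardK cK eqxx (subset_trans sKV (subsetDl _ _)).
by rewrite !inE eqxx.
Qed.

(** Induction on [t]: each round deletes one vertex and lowers [t] by one, which preserves the bound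
    on |V|. *)
Lemma exists_large_K_free_subset s t V :
    0 < s -> #|V| + 2 <= s.*2 + t -> ~~ induced_has_K G V (s + t) ->
  exists2 S, ~~ induced_has_K G S s & #|V| - t <= #|S|.
Proof.
move=> s_gt0; elim: t V => [|t IHt] V leV noK.
  by exists V; rewrite ?subn0 // -[s]addn0.
have [V0|[v0 Vv0]] := set_0Vmem V.
  exists set0; last by rewrite V0 cards0.
  apply/induced_has_KP=> -[K []]; rewrite subset0 => /eqP-> s0 _.
  by rewrite -s0 cards0 in s_gt0.
have [v Vv noKv] : exists2 v, v \in V & ~~ induced_has_K G (V :\ v) (s + t).
  (* If a clique of size w = s + t exists, w is the clique number of [V], and |V| <= 2s + t - 1 <
     2w. Otherwise any vertex may be deleted. *)
  have [hasK|noK'] := boolP (induced_has_K G V (s + t)).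
    by apply: exists_clique_transversal_vertex => //; [lia|rewrite -addnS].
  by exists v0 => //; apply: contra noK'; apply/induced_has_K_sub/subsetDl.
have cardV := cardsD1 v V; rewrite Vv in cardV.
have [|S noS leS] := IHt (V :\ v) _ noKv; first lia.
by exists S => //; lia.
Qed.

End Cliques.

Section CliqueWithIsolatedVertices.

Variables (T : finType) (A : {set T}).

Definition complete_on_edges : {set {set T}} :=
  [set e : {set T} | (e \subset A) && (#|e| == 2)].

Lemma complete_on_edges_card2 : [forall e in complete_on_edges, #|e| == 2].
Proof. by apply/forall_inP=> e; rewrite inE => /andP[]. Qed.

Definition complete_on : graph T :=
  exist _ complete_on_edges complete_on_edges_card2.

Lemma adjacent_complete_on x y :
  adjacent complete_on x y = [&& x \in A, y \in A & x != y].
Proof.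
by rewrite /adjacent inE subUset !sub1set cards2 -andbA; case: (x != y).
Qed.

Lemma clique_complete_on (K : {set T}) : K \subset A -> clique complete_on K.
Proof.
move/subsetP=> sKA; apply/cliqueP=> x y /sKA Ax /sKA Ay neq_xy.
by rewrite adjacent_complete_on Ax Ay.
Qed.

Lemma complete_on_K_free r : 1 < r -> #|A| < r -> K_free complete_on r.
Proof.
move=> r_gt1 ltAr; apply/induced_has_KP=> -[K [_ cardK /cliqueP cK]].
suff /subset_leq_card : K \subset A by lia.
apply/subsetP=> x Kx.
(* As r > 1, [x] has a neighbour in [K], and only vertices of [A] have neighbours. *)
have /card_gt0P[y] : 0 < #|K :\ x| by have := cardsD1 x K; rewrite Kx; lia.
rewrite !inE eq_sym => /andP[neq_xy Ky].
by have := cK x y Kx Ky neq_xy; rewrite adjacent_complete_on => /andP[].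
Qed.

Lemma max_induced_K_free_complete_on s :
  0 < s -> max_induced_K_free complete_on s <= #|T| - (#|A| - s.-1).
Proof.
move=> s_gt0; apply/bigmax_leqP=> S noK.
have ltSA : #|S :&: A| < s.
  rewrite ltnNge; apply: contra noK.
  apply: induced_has_K_le; first exact: subsetIl.
  exact/clique_complete_on/subsetIr.
have leT : #|S :|: A| <= #|T| := max_card _.
by have := subset_leq_card (subsetUl S A); have := cardsUI S A; lia.
Qed.

End CliqueWithIsolatedVertices.

Theorem theorem2 (s t n : nat) (s_gt0 : 0 < s) (t_gt0 : 0 < t) (n_gt0 : 0 < n)
    (s_big : (n - t + 1) %/ 2 < s) (st_le : s + t <= n + 1) :
  erdos_rogers s (s + t) n = n - t.
Proof.
rewrite /erdos_rogers; apply/eqP; rewrite eqn_leq; apply/andP; split.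
  (* The largest clique allowed in a K_(s+t)-free graph; it fits by [st_le]. A K_s-free set then
     misses at least (s + t - 1) - (s - 1) = t vertices. *)
  have [|A _ cardA] := @exists_subset_card _ [set: 'I_n] (s + t).-1.
    by rewrite cardsT card_ord; lia.
  have free : K_free (complete_on A) (s + t).
    by apply: complete_on_K_free; rewrite ?cardA; lia.
  have le_min := bigminn_le_cond (P := fun G => K_free G (s + t))
    (fun G => max_induced_K_free G s) n free.
  apply: leq_trans le_min _.
  have := max_induced_K_free_complete_on A s_gt0.
  by rewrite card_ord cardA; lia.
(* The first case is the default value [n] of the minimum. *)
apply: (big_ind (fun m => n - t <= m)) => [|x y lex ley|G noK].
- exact: leq_subr.
- by rewrite leq_min lex.
(* [s_big] says n - t + 1 < 2s, that is n + 2 <= 2s + t. *)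
have [|S noS leS] := exists_large_K_free_subset s_gt0 _ noK.
  by rewrite cardsT card_ord; lia.
rewrite cardsT card_ord in leS; apply: leq_trans leS _.
exact: (@leq_bigmax_cond _ _ (fun S : {set 'I_n} => #|S|)).
Qed.
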